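(* Let $n\ge 2$. Then the perfect matching complex $\mathcal{M}_p(H_{1\times 2\times n})$ of the honeycomb graph $H_{1\times 2\times n}$ is homotopy equivalent to the sphere $S^{n-1}$.
   Context: For a finite simple graph $G$, a perfect matching is a set of pairwise vertex-disjoint edges covering every vertex. The perfect matching complex $\mathcal{M}_p(G)$ is the simplicial complex on vertex set $E(G)$ whose faces are the subsets of perfect matchings of $G$. For integers $m,n\ge 1$, the honeycomb graph $H_{1\times m\times n}$ is the planar graph formed by $mn$ hexagonal cells $T_{i,j}$ ($1\le i\le m$, $1\le j\le n$) of the hexagonal lattice arranged as a parallelogram: each hexagon is drawn with a horizontal top and bottom edge; $T_{i,j+1}$ lies directly above $T_{i,j}$ and shares the top edge of $T_{i,j}$; $T_{i+1,j}$ shares the lower-right edge of $T_{i,j}$; and $T_{i+1,j+1}$ shares the upper-right edge of $T_{i,j}$. Its vertices and edges are those of the cells. (Equivalently, it is the honeycomb graph whose perfect matchings correspond to plane partitions in a $1\times m$ box with entries at most $n$.) *)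

(* Defs.v *)
From HB Require Import structures.
From mathcomp Require Import all_boot all_order all_algebra zify.
From mathcomp Require Import all_classical all_reals all_analysis.

Set Implicit Arguments.
Unset Strict Implicit.
Unset Printing Implicit Defensive.

Import Order.TTheory GRing.Theory Num.Theory.
Import numFieldNormedType.Exports.

Local Open Scope ring_scope.

Record simple_graph := SimpleGraph {
  vertex :> finType;
  adj : rel vertex;
  adj_sym : symmetric adj;
  adj_irr : irreflexive adj
}.

Arguments adj {G} : rename.

Definition is_edge (G : simple_graph) (e : {set G}) : bool :=
  [exists u, [exists v, adj u v && (e == [set u; v]%SET)]].

Definition edge (G : simple_graph) : finType := {e : {set G} | is_edge e}.

Definition perfect_matching (G : simple_graph) (M : {set edge G}) : bool :=
  [forall e in M, [forall f in M, (e != f) ==> [disjoint val e & val f]]]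
  && [forall v : G, [exists e in M, v \in val e]].

(* The empty face is allowed, and a point of [V] need not be a face. *)
Record simplicial_complex (V : finType) := SimplicialComplex {
  faces :> {set {set V}};
  faces_closed :
    forall s t : {set V}, t \subset s -> s \in faces -> t \in faces
}.

Definition matching_faces (G : simple_graph) : {set {set edge G}} :=
  [set s : {set edge G} |
    [exists M : {set edge G}, perfect_matching M && (s \subset M)]]%SET.

Lemma matching_faces_closed (G : simple_graph) (s t : {set edge G}) :
  t \subset s -> s \in matching_faces G -> t \in matching_faces G.
Proof.
rewrite !inE => ts /existsP[M /andP[pM sM]].
by apply/existsP; exists M; rewrite pM (fintype.subset_trans ts sM).
Qed.

Definition perfect_matching_complex (G : simple_graph) :
    simplicial_complex (edge G) :=
  SimplicialComplex (@matching_faces_closed G).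

(* A pair (x, y) of integers stands for the point of the plane with Cartesian
   coordinates (x / 2, y * sqrt 3 / 2): the six corners of the unit hexagon
   centred at (x, y) with horizontal top and bottom edges are then integral.
   They are listed clockwise from the top-right one. *)
Definition hexagon (c : int * int) : seq (int * int) :=
  let: (x, y) := c in
  [:: (x + 1, y + 1); (x + 2, y); (x + 1, y - 1);
      (x - 1, y - 1); (x - 2, y); (x - 1, y + 1)].

(* The step (0, 2) crosses the top edge of a cell, (3, -1) its lower-right
   edge and (3, 1) its upper-right edge. *)
Definition cell (i j : nat) : seq (int * int) :=
  hexagon (3 * i%:Z, 2 * j%:Z - i%:Z).

Definition cells (m n : nat) : seq (seq (int * int)) :=
  [seq cell i j | i <- iota 1 m, j <- iota 1 n].

Definition sides (c : seq (int * int)) : seq ((int * int) * (int * int)) :=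
  zip c (rot 1 c).

Definition honeycomb_vertex (m n : nat) : finType :=
  seq_sub (flatten (cells m n)).

Definition honeycomb_adj (m n : nat) : rel (honeycomb_vertex m n) :=
  fun u v => has (fun c => ((val u, val v) \in sides c)
                           || ((val v, val u) \in sides c)) (cells m n).

Lemma honeycomb_adj_sym (m n : nat) : symmetric (@honeycomb_adj m n).
Proof. by move=> u v; apply: eq_has => c; rewrite orbC. Qed.

Lemma honeycomb_adj_irr (m n : nat) : irreflexive (@honeycomb_adj m n).
Proof.
move=> u; apply/hasP => -[c /allpairsP[[i j] [_ _ ->]]].
rewrite orbb /cell /hexagon /sides /= !inE /= !xpair_eqE.
by case: (val u : int * int) => a b; rewrite !xpair_eqE; lia.
Qed.

(* The graph H_{1 x m x n}. *)
Definition honeycomb (m n : nat) : simple_graph :=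
  SimpleGraph (@honeycomb_adj_sym m n) (@honeycomb_adj_irr m n).

Local Open Scope classical_set_scope.

(* Barycentric coordinates; as [V] is finite, the product topology on [V -> R]
   is the Euclidean one. *)
Definition geometric_realization (R : realType) (V : finType)
    (K : simplicial_complex V) : topologicalType :=
  set_type [set x : {ptws V -> R} |
    [/\ forall v, 0 <= x v,
        \sum_v x v = 1
      & [set v | x v != 0]%SET \in faces K]].

(* The sphere S^d, in R^(d+1). *)
Definition sphere (R : realType) (d : nat) : topologicalType :=
  set_type [set x : 'rV[R]_d.+1 | \sum_i x 0 i ^+ 2 = 1].

Definition homotopic (R : realType) (X Y : topologicalType) (f g : X -> Y) :
    Prop :=
  exists H : X * R -> Y,
    [/\ {within [set: X] `*` `[0, 1], continuous H},
        forall x, H (x, 0) = f x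
      & forall x, H (x, 1) = g x].

Definition homotopy_equivalent (R : realType) (X Y : topologicalType) : Prop :=
  exists (f : X -> Y) (g : Y -> X),
    [/\ continuous f, continuous g,
        homotopic R (g \o f) idfun & homotopic R (f \o g) idfun].

(* Main.v *)
(** Write a perfect matching of H_{1 x 2 x n} as a pair (a, b) with
    0 <= b <= a <= n, where a and b are the heights of the unique horizontal
    edge that it contains in the first and in the second column of cells.  An
    edge is then determined, as far as faces are concerned, by the set of pairs
    (a, b) whose matching contains it.  Every such set is contained in one of
    the n + 1 sets {a > 0}, {b < n} and {i < b or a < i}, for 0 < i < n, each
    of which belongs to a [special] edge.  Replacing every edge by a special
    one that lies in all the perfect matchings containing it is a simplicial
    retraction of the complex onto its special part, and moving every point
    straight to its image is a homotopy.  The matching (k, k) contains all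
    special edges but the k-th, and no perfect matching contains all of them,
    so the special part is the boundary of a simplex with n + 1 vertices. *)

Require Import Defs.
From mathcomp Require Import all_boot all_order all_algebra ring zify.
From mathcomp Require Import all_classical all_reals all_analysis.

Set Implicit Arguments.
Unset Strict Implicit.
Unset Printing Implicit Defensive.

Import Order.TTheory GRing.Theory Num.Theory.
Import numFieldNormedType.Exports.

Local Open Scope ring_scope.
Local Open Scope classical_set_scope.

(** * Continuity of maps into subspaces, function spaces and row vectors *)

Definition mk_set_type (T : Type) (A : set T) (x : T) (Ax : A x) : set_type A :=
  exist _ x (mem_set Ax).

Lemma continuous_set_type (X Y : topologicalType) (A : set Y)
    (f : X -> set_type A) :
  continuous (fun x => set_val (f x)) -> continuous f.
Proof. exact: (@continuous_comp_initial _ _ _ set_val). Qed.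

Lemma continuous_set_val (Y : topologicalType) (A : set Y) :
  continuous (set_val : set_type A -> Y).
Proof. exact: initial_continuous. Qed.

Lemma continuous_ptws (X : topologicalType) (V : eqType) (Y : topologicalType)
    (f : X -> {ptws V -> Y}) :
  (forall v, continuous (fun x => f x v)) -> continuous f.
Proof.
move=> cf x; apply/cvg_sup => v U [_ [[W oW <-]] /= Wfx WU].
by apply: (filterS WU); apply: (cf v); exact: open_nbhs_nbhs.
Qed.

Lemma continuous_rV (R : realType) (X : topologicalType) (d : nat)
    (f : X -> 'rV[R]_d) :
  (forall i, continuous (fun x => f x 0 i)) -> continuous f.
Proof.
move=> cf x U [P nP PU].
have : \forall y \near x, forall i j, P i j (f y i j).
  apply: filter_forall => i; apply: filter_forall => j.
  by rewrite ord1; apply: (cf j); exact: nP.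
by apply: filterS => y /PU.
Qed.

Lemma continuous_ptws_coord (V : eqType) (Y : topologicalType) (v : V) :
  continuous (fun x : {ptws V -> Y} => x v).
Proof. exact: (@proj_continuous V (fun=> Y) v). Qed.

(** * The boundary of a simplex is a sphere *)

Section sphere_coordinates.
Variables (R : realType) (d : nat).
Implicit Types (y : 'I_d.+2 -> R) (z u : 'rV[R]_d.+1).

Definition simplex_boundary y :=
  [/\ forall i, 0 <= y i, \sum_i y i = 1 & exists i, y i = 0].

Definition row_norm u : R := Num.sqrt (\sum_i u 0 i ^+ 2).

(* Its kernel is the line of constant vectors, which misses the boundary of the
   simplex: radial projection is thus defined on its image, and its inverse
   shifts a vector by its smallest entry. *)
Definition differences y : 'rV[R]_d.+1 :=
  \row_j (y (lift ord_max j) - y ord_max).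

Definition to_sphere y := (row_norm (differences y))^-1 *: differences y.

(** The preimage of [z] under [differences] whose last entry is 0. *)
Definition extend0 z (i : 'I_d.+2) : R :=
  if unlift ord_max i is Some j then z 0 j else 0.

Definition shifted z (i : 'I_d.+2) : R :=
  extend0 z i - \big[Num.min/0]_k extend0 z k.

Definition to_boundary z (i : 'I_d.+2) : R := shifted z i / \sum_k shifted z k.

Lemma row_norm_ge0 u : 0 <= row_norm u.
Proof. exact: sqrtr_ge0. Qed.

Lemma sqr_row_norm u : row_norm u ^+ 2 = \sum_i u 0 i ^+ 2.
Proof. by rewrite sqr_sqrtr// sumr_ge0// => i _; exact: sqr_ge0. Qed.

Lemma row_norm_eq0 u : row_norm u = 0 -> u = 0.
Proof.
move=> u0; have /eqP := sqr_row_norm u.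
rewrite u0 expr0n eq_sym psumr_eq0 => [|i _]; last exact: sqr_ge0.
move=> /allP u2; apply/rowP => i; rewrite mxE.
by have /implyP/(_ isT) := u2 i (mem_index_enum i); rewrite sqrf_eq0 => /eqP.
Qed.

Lemma row_normZ (c : R) u : 0 <= c -> row_norm (c *: u) = c * row_norm u.
Proof.
move=> c0; rewrite /row_norm.
under eq_bigr do rewrite mxE exprMn.
by rewrite -mulr_sumr sqrtrM ?sqr_ge0// sqrtr_sqr ger0_norm.
Qed.

Lemma row_norm1 u : \sum_i u 0 i ^+ 2 = 1 -> row_norm u = 1.
Proof. by rewrite /row_norm => ->; rewrite sqrtr1. Qed.

(** Vanishing differences make [y] constant, hence equal to its zero entry everywhere, which
    contradicts the sum 1. *)
Lemma differences_neq0 y : simplex_boundary y -> differences y != 0.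
Proof.
move=> [_ y1 [k yk]]; apply/eqP => /rowP y0.
have yE i : y i = y ord_max.
  case: (unliftP ord_max i) => [j|] ->//.
  by have := y0 j; rewrite !mxE => /eqP; rewrite subr_eq0 => /eqP.
have : \sum_i y i = 0 by rewrite big1// => i _; rewrite yE -(yE k).
by rewrite y1 => /eqP; rewrite oner_eq0.
Qed.

Lemma row_norm_differences_gt0 y :
  simplex_boundary y -> 0 < row_norm (differences y).
Proof.
move=> /differences_neq0 y0; rewrite lt_neqAle row_norm_ge0 andbT eq_sym.
by apply: contra_neq y0 => /row_norm_eq0.
Qed.

Lemma to_sphere_in y :
  simplex_boundary y -> \sum_i to_sphere y 0 i ^+ 2 = 1.
Proof.
move=> /row_norm_differences_gt0 N0; rewrite -sqr_row_norm.
rewrite row_normZ ?invr_ge0 ?row_norm_ge0//.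
by rewrite mulVf ?expr1n// gt_eqF.
Qed.

Lemma extend0_lift z j : extend0 z (lift ord_max j) = z 0 j.
Proof. by rewrite /extend0 liftK. Qed.

Lemma extend0_max z : extend0 z ord_max = 0.
Proof. by rewrite /extend0 unlift_none. Qed.

Lemma min_extend0_le z i : \big[Num.min/0]_k extend0 z k <= extend0 z i.
Proof. exact: bigmin_le_cond. Qed.

(** The default value 0 of the minimum is harmless: it is the entry at [ord_max]. *)
Lemma min_extend0_mem z :
  exists i, \big[Num.min/0]_k extend0 z k = extend0 z i.
Proof.
elim/big_ind: _ => [|a b [i ->] [j ->]|i _]; last by exists i.
  by exists ord_max; rewrite extend0_max.
by case: leP => _; [exists i|exists j].
Qed.

Lemma shifted_ge0 z i : 0 <= shifted z i.
Proof. by rewrite subr_ge0 min_extend0_le. Qed.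

(** If the sum vanished, all entries of [extend0 z] would agree with the last one, which is 0, and
    [z] would be off the sphere. *)
Lemma sum_shifted_gt0 z : \sum_i z 0 i ^+ 2 = 1 -> 0 < \sum_i shifted z i.
Proof.
move=> z1; rewrite lt_neqAle sumr_ge0 ?andbT => [|i _]; last exact: shifted_ge0.
apply/eqP => /esym/eqP; rewrite psumr_eq0 => [/allP s0|i _]; last first.
  exact: shifted_ge0.
have eE i : extend0 z i = \big[Num.min/0]_k extend0 z k.
  by apply/eqP; rewrite -subr_eq0; exact: (implyP (s0 i (mem_index_enum i))).
move: z1; rewrite big1 => [/eqP|j _]; first by rewrite eq_sym oner_eq0.
by rewrite -extend0_lift eE -(eE ord_max) extend0_max expr0n.
Qed.

Lemma to_boundary_in z :
  \sum_i z 0 i ^+ 2 = 1 -> simplex_boundary (to_boundary z).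
Proof.
move=> /sum_shifted_gt0 S0; split => [i||].
- by rewrite divr_ge0 ?shifted_ge0// ltW.
- by rewrite -mulr_suml divff// gt_eqF.
- have [i mE] := min_extend0_mem z; exists i.
  by rewrite /to_boundary /shifted mE subrr mul0r.
Qed.

(** Subtracting the minimum does not affect [differences], so a positive multiple of [z] is left,
    and normalising it returns [z]. *)
Lemma to_boundaryK z : \sum_i z 0 i ^+ 2 = 1 -> to_sphere (to_boundary z) = z.
Proof.
move=> z1; have S0 := sum_shifted_gt0 z1.
have -> : to_sphere (to_boundary z) =
    to_sphere (fun i => (\sum_k shifted z k)^-1 * extend0 z i).
  rewrite /to_sphere; suff -> : differences (to_boundary z) =
    differences (fun i => (\sum_k shifted z k)^-1 * extend0 z i) by [].
  by apply/rowP => j; rewrite !mxE /to_boundary {1 3}/shifted; ring.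
rewrite /to_sphere (_ : differences _ = (\sum_k shifted z k)^-1 *: z).
  rewrite row_normZ ?invr_ge0 ?(ltW S0)// row_norm1// mulr1 invrK.
  by rewrite scalerA divff ?scale1r// gt_eqF.
by apply/rowP => j; rewrite !mxE extend0_lift extend0_max mulr0 subr0.
Qed.

Lemma to_sphereK y : simplex_boundary y -> to_boundary (to_sphere y) =1 y.
Proof.
move=> yB; have N0 := row_norm_differences_gt0 yB.
set c := (row_norm (differences y))^-1.
have c0 : 0 < c by rewrite invr_gt0.
have eE i : extend0 (to_sphere y) i = c * (y i - y ord_max).
  case: (unliftP ord_max i) => [j|] ->; last by rewrite extend0_max subrr mulr0.
  by rewrite extend0_lift !mxE.
have [yge0 y1 [k yk]] := yB.
(* The minimum is attained where [y] vanishes, at [k]. Subtracting it leaves [c * y], and the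
   division by the sum removes [c]. *)
have mE : \big[Num.min/0]_k extend0 (to_sphere y) k = - (c * y ord_max).
  apply/eqP; rewrite eq_le; apply/andP; split.
    by rewrite (le_trans (min_extend0_le _ k))// eE yk sub0r mulrN.
  have [i ->] := min_extend0_mem (to_sphere y).
  by rewrite eE mulrBr lerBDl subrr mulr_ge0// ltW.
have sE i : shifted (to_sphere y) i = c * y i by rewrite /shifted mE eE; ring.
move=> i; rewrite /to_boundary; under eq_bigr do rewrite sE.
by rewrite sE -mulr_sumr y1 mulr1 mulrC mulKf// gt_eqF.
Qed.

Variable X : topologicalType.

Lemma continuous_to_sphere (g : X -> 'I_d.+2 -> R) :
  (forall x, simplex_boundary (g x)) ->
  (forall i, continuous (fun x => g x i)) ->
  continuous (fun x => to_sphere (g x)).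
Proof.
move=> gB gc; apply: continuous_rV => j.
have dc i : continuous (fun x => differences (g x) 0 i).
  move=> x; under eq_fun do rewrite mxE.
  by apply: cvgB; exact: gc.
move=> x; under eq_fun do rewrite mxE.
apply: cvgM; last exact: dc.
apply: cvgV; first by rewrite gt_eqF// row_norm_differences_gt0.
apply: (@continuous_comp _ _ _ (fun x => \sum_i differences (g x) 0 i ^+ 2)
  Num.sqrt); last exact: sqrt_continuous.
apply: cvg_big => [|i _]; last by apply: cvgM; exact: dc.
exact: add_continuous.
Qed.

Lemma continuous_to_boundary (g : X -> 'rV[R]_d.+1) :
  (forall x, \sum_i g x 0 i ^+ 2 = 1) ->
  (forall i, continuous (fun x => g x 0 i)) ->
  forall i, continuous (fun x => to_boundary (g x) i).
Proof.
move=> g1 gc.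
have ec i : continuous (fun x => extend0 (g x) i).
  rewrite /extend0; case: unlift => [j|]; first exact: gc.
  by move=> x; exact: cvg_cst.
have sc i : continuous (fun x => shifted (g x) i).
  move=> x; apply: cvgB; first exact: ec.
  apply: cvg_big => [|k _]; last exact: ec.
  exact: min_continuous.
move=> i x; apply: cvgM; first exact: sc.
apply: cvgV; first by rewrite gt_eqF// sum_shifted_gt0.
apply: cvg_big => [|k _]; last exact: sc.
exact: add_continuous.
Qed.

End sphere_coordinates.

(** * Retraction onto dominating vertices *)

(** The linear map that [h] induces on barycentric coordinates. *)
Definition pushforward (R : realType) (A B : finType) (h : A -> B)
    (x : A -> R) (b : B) : R :=
  \sum_(a | h a == b) x a.

Section pushforward.
Variables (R : realType) (A B : finType) (h : A -> B) (x : A -> R).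
Hypothesis x0 : forall a, 0 <= x a.

Lemma pushforward_ge0 b : 0 <= pushforward h x b.
Proof. exact: sumr_ge0. Qed.

Lemma sum_pushforward : \sum_b pushforward h x b = \sum_a x a.
Proof. by rewrite [RHS](partition_big h xpredT). Qed.

(** Non-negative coordinates cannot cancel, so the support is carried exactly onto its image. *)
Lemma pushforward_neq0 b :
  (pushforward h x b != 0) = (b \in h @: [set a | x a != 0])%SET.
Proof.
apply/idP/imsetP => [hb|[a]].
  apply: contra_neqP hb => nb; apply: big1 => a /eqP ab.
  apply/eqP; apply: contra_notT nb => xa; exists a => //.
  by rewrite inE.
rewrite inE => xa ->; rewrite psumr_neq0//; apply/hasP.
by exists a; rewrite ?mem_index_enum// eqxx lt_neqAle eq_sym xa x0.
Qed.

End pushforward.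

Lemma pushforwardK (R : realType) (A B : finType) (f : A -> B) (r : B -> A)
    (x : A -> R) :
  cancel f r -> pushforward r (pushforward f x) =1 x.
Proof.
move=> fK a; rewrite -(big_pred1_eq +%R a x).
rewrite (partition_big f (fun b => r b == a)).
  apply: eq_bigr => b /eqP rb; apply: eq_bigl => c.
  by have [fcb|_] := eqVneq (f c) b; rewrite ?andbF// -rb -fcb fK eqxx.
by move=> c /eqP ->; rewrite fK.
Qed.

Lemma continuous_pushforward (R : realType) (X : topologicalType)
    (A B : finType) (h : A -> B) (g : X -> A -> R) :
  (forall a, continuous (fun x => g x a)) ->
  forall b, continuous (fun x => pushforward h (g x) b).
Proof.
move=> gc b x; apply: cvg_big => [|a _]; last exact: gc.
exact: add_continuous.
Qed.

(* Lets a homotopy be defined at every real time, as [homotopic] requires. *)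
Definition clamp01 (R : realType) (t : R) : R := Num.max 0 (Num.min t 1).

Lemma clamp01_ge0 (R : realType) (t : R) : 0 <= clamp01 t.
Proof. by rewrite le_max lexx. Qed.

Lemma clamp01_le1 (R : realType) (t : R) : clamp01 t <= 1.
Proof. by rewrite ge_max ler01 ge_min lexx orbT. Qed.

Lemma continuous_clamp01 (R : realType) : continuous (@clamp01 R).
Proof.
move=> t; apply: (@continuous_max R R (cst 0) (fun t => Num.min t 1) t).
  exact: cvg_cst.
by apply: (@continuous_min R R id (cst 1) t); [exact: cvg_id|exact: cvg_cst].
Qed.

Section dominated_complex.
Variables (R : realType) (V : finType) (K : simplicial_complex V) (d : nat).
Variable f : 'I_d.+2 -> V.
(** The vertices [f i] are thus distinct and span the boundary of a simplex as a full subcomplex. *)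
Hypothesis face_f : forall t : {set 'I_d.+2},
  (f @: t \in faces K) = (t != [set: _])%SET.

(** For a vertex [v] of the complex other than [f i], this means that the link of [v] is a cone with
    apex [f i]. *)
Let dominates i v := forall s : {set V}, s \in faces K -> v \in s ->
  (f i |: s \in faces K)%SET.

(** Any choice of dominating indices is already a retraction. If [r (f i)] differed from [i], the
    face of all [f j] with [j != r (f i)] would contain [f i] and could be enlarged by [f (r (f i))]
    to the forbidden full set. *)
Lemma domination_retract :
  (forall v, exists i, dominates i v) ->
  exists2 r : V -> 'I_d.+2, cancel f r & forall v, dominates (r v) v.
Proof.
move=> /choice[r dom_r]; exists r => // i; apply/eqP/negP => /negP ri.
have : (f (r (f i)) |: f @: [set~ r (f i)] \in faces K)%SET.
  apply: dom_r.
    by rewrite face_f; apply/eqP => /setP/(_ (r (f i))); rewrite !inE eqxx.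
  by apply: imset_f; rewrite !inE eq_sym.
rewrite -imsetU1 face_f => /eqP; apply; apply/setP => j.
by rewrite !inE orbN.
Qed.

Variable r : V -> 'I_d.+2.
Hypotheses (fK : cancel f r) (dom_r : forall v, dominates (r v) v).

(** The images are added one vertex at a time: each enlarged face still contains [s], so domination
    applies again. *)
Lemma face_retract s : (s \in faces K -> f @: (r @: s) :|: s \in faces K)%SET.
Proof.
move=> sK; rewrite -imset_comp.
suff H (l : seq V) : {subset l <= s} ->
    ([set x in map (f \o r) l] :|: s \in faces K)%SET.
  apply: faces_closed (H (enum s) _); last by move=> v; rewrite mem_enum.
  apply: finset.setSU; apply/fintype.subsetP => v /imsetP[w ws ->].
  by rewrite inE map_f// mem_enum.
elim: l => [_|v l IHl vls].
  suff -> : [set x in map (f \o r) [::]]%SET = finset.set0.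
    by rewrite finset.set0U.
  by apply/setP => v; rewrite !inE.
rewrite set_cons -finset.setUA; apply: dom_r; last first.
  by rewrite inE vls ?orbT// mem_head.
by apply: IHl => w wl; apply: vls; rewrite inE wl orbT.
Qed.

Lemma face_retract_proper s : s \in faces K -> (r @: s != [set: _])%SET.
Proof.
move=> /face_retract; rewrite -face_f; apply: faces_closed.
exact: finset.subsetUl.
Qed.

Let in_realization (x : V -> R) :=
  [/\ forall v, 0 <= x v, \sum_v x v = 1 & [set v | x v != 0]%SET \in faces K].

Lemma realization_to_boundary x :
  in_realization x -> simplex_boundary (pushforward r x).
Proof.
move=> [x0 x1 xK]; split; first exact: pushforward_ge0.
  by rewrite sum_pushforward.
have /eqP := face_retract_proper xK.
apply: contra_notP => /forallNP nz; apply/setP => i.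
by rewrite inE -pushforward_neq0//; apply/eqP.
Qed.

Lemma boundary_to_realization y :
  simplex_boundary y -> in_realization (pushforward f y).
Proof.
move=> [y0 y1 [i yi]]; split; first exact: pushforward_ge0.
  by rewrite sum_pushforward.
rewrite (_ : [set _ | _] = f @: [set i | y i != 0])%SET; last first.
  by apply/setP => v; rewrite inE pushforward_neq0.
by rewrite face_f; apply/eqP => /setP/(_ i); rewrite !inE yi eqxx.
Qed.

Definition segment (t : R) (x : V -> R) (v : V) : R :=
  t * x v + (1 - t) * pushforward f (pushforward r x) v.

Lemma continuous_segment (X : topologicalType) (t : X -> R) (g : X -> V -> R) :
  (forall v, continuous (fun x => g x v)) -> continuous t ->
  forall v, continuous (fun x => segment (t x) (g x) v).
Proof.
move=> gc tc v x; apply: cvgD; apply: cvgM.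
- exact: tc.
- exact: gc.
- by apply: cvgB; [exact: cvg_cst|exact: tc].
- by do 2! apply: continuous_pushforward => ?.
Qed.

(* The support of [x] and that of its retraction lie in a common face. *)
Lemma segment_in_realization t x :
  0 <= t <= 1 -> in_realization x -> in_realization (segment t x).
Proof.
move=> /andP[t0 t1] xK; have [x0 x1 sK] := xK.
have rx := realization_to_boundary xK; have [rx0 _ _] := rx.
have [y0 y1 _] := boundary_to_realization rx.
split=> [v||].
- by rewrite addr_ge0// mulr_ge0// subr_ge0.
- by rewrite big_split/= -!mulr_sumr x1 y1; ring.
- apply: faces_closed (face_retract sK); apply/fintype.subsetP => v.
  rewrite !inE; apply: contra_neqT; rewrite negb_or negbK => /andP[nv /eqP xv].
  rewrite /segment xv mulr0 add0r.
  suff -> : pushforward f (pushforward r x) v = 0 by rewrite mulr0.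
  apply/eqP; apply: contraNT nv; rewrite pushforward_neq0//.
  rewrite (_ : [set _ | _] = r @: [set v | x v != 0])%SET//.
  by apply/setP => i; rewrite inE pushforward_neq0.
Qed.

Local Notation KR := (geometric_realization R K).

Let realizationP (x : KR) : in_realization (set_val x).
Proof. exact: (@set_valP _ _ x). Qed.

Let sphereP (z : sphere R d) : \sum_i (set_val z : 'rV[R]_d.+1) 0 i ^+ 2 = 1.
Proof. exact: (@set_valP _ _ z). Qed.

Lemma realization_homotopy_sphere : homotopy_equivalent R KR (sphere R d).
Proof.
pose F (x : KR) : sphere R d :=
    mk_set_type (A := [set u : 'rV[R]_d.+1 | \sum_i u 0 i ^+ 2 = 1])
      (to_sphere_in (realization_to_boundary (realizationP x))).
pose G (z : sphere R d) : KR :=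
    mk_set_type (A := [set x : {ptws V -> R} | in_realization x])
      (boundary_to_realization (to_boundary_in (sphereP z))).
have valc v : continuous (fun x : KR => (set_val x : V -> R) v).
  move=> x.
  apply: (@continuous_comp _ _ _ set_val (fun x : {ptws V -> R} => x v)).
    exact: continuous_set_val.
  exact: continuous_ptws_coord.
have FG : F \o G =1 idfun.
  move=> z; apply: val_inj => /=.
  rewrite -[RHS](to_boundaryK (sphereP z)).
  by rewrite (funext (pushforwardK _ fK)).
have GF x : set_val (G (F x)) = pushforward f (pushforward r (set_val x)).
  rewrite /=; congr pushforward; apply/funext => i.
  exact: (to_sphereK (realization_to_boundary (realizationP x))).
exists F, G; split.
- apply: continuous_set_type; apply: continuous_to_sphere => [x|i].
    exact: realization_to_boundary.
  exact: continuous_pushforward.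
- apply: continuous_set_type; apply: continuous_ptws => v.
  apply: continuous_pushforward => i.
  apply: continuous_to_boundary => [z|j]; first exact: sphereP.
  move=> z.
  apply: (@continuous_comp _ _ _ set_val (fun x : 'rV[R]_d.+1 => x 0 j)).
    exact: continuous_set_val.
  exact: coord_continuous.
- have c01 (t : R) : 0 <= clamp01 t <= 1 by rewrite clamp01_ge0 clamp01_le1.
  pose H (p : KR * R) : KR :=
    mk_set_type (A := [set x : {ptws V -> R} | in_realization x])
      (segment_in_realization (c01 p.2) (realizationP p.1)).
  exists H; split => [|x|x].
  + apply: continuous_subspaceT; apply: continuous_set_type.
    apply: continuous_ptws => v.
    apply: (@continuous_segment _ (fun p : KR * R => clamp01 p.2)
      (fun p => set_val p.1 : V -> R) _ _ v) => [w|] p.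
      apply: (@continuous_comp _ _ _ fst
        (fun x : KR => (set_val x : V -> R) w)).
        exact: cvg_fst.
      exact: valc.
    apply: (@continuous_comp _ _ _ snd (@clamp01 R)); first exact: cvg_snd.
    exact: continuous_clamp01.
  + apply: val_inj; rewrite -[RHS]/(set_val (G (F x))) GF; apply/funext => v.
    rewrite /= /segment /clamp01 min_l ?ler01// maxxx.
    by rewrite mul0r add0r subr0 mul1r.
  + apply: val_inj; apply/funext => v.
    rewrite /= /segment /clamp01 minxx max_r ?ler01//.
    by rewrite mul1r subrr mul0r addr0.
(* [F \o G] is the identity, so the constant homotopy serves. *)
- exists fst; split => [|z|//]; last by rewrite FG.
  by apply: continuous_subspaceT => p; exact: cvg_fst.
Qed.

End dominated_complex.

Local Close Scope classical_set_scope.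

(** * Perfect matchings as involutions *)

Section perfect_matchings.
Variable G : simple_graph.
Implicit Types (mu : G -> G) (M : {set edge G}).

Definition matching_of mu : {set edge G} :=
  [set e : edge G | [exists u, val e == [set u; mu u]]]%SET.

Lemma perfect_matching_of mu :
  involutive mu -> (forall u, adj u (mu u)) ->
  perfect_matching (matching_of mu).
Proof.
move=> muK adj_mu; apply/andP; split; last first.
  apply/forallP => v; have ve : is_edge [set v; mu v]%SET.
    apply/existsP; exists v; apply/existsP; exists (mu v).
    by rewrite adj_mu eqxx.
  apply/existsP; exists (exist (fun e : {set G} => is_edge e) _ ve : edge G).
  rewrite !inE /= eqxx andbT; apply/existsP; exists v; exact: eqxx.
(* An edge of the matching is determined by either of its ends, so two edges that meet coincide. *)
have share (e : edge G) x : e \in matching_of mu -> x \in val e ->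
    val e = [set x; mu x]%SET.
  rewrite inE => /existsP[u /eqP ->]; rewrite !inE => /orP[/eqP -> //|/eqP ->].
  by rewrite muK finset.setUC.
apply/forallP => e; apply/implyP => eM; apply/forallP => f; apply/implyP => fM.
apply/implyP; apply: contraNT => /pred0Pn[x /= /andP[xe xf]].
by apply/eqP/val_inj; rewrite (share e x)// (share f x).
Qed.

(** The partner of a vertex is the other end of the edge that covers it; disjointness makes this
    edge unique, so taking partners is an involution. *)
Lemma perfect_matching_partner M : perfect_matching M ->
  exists mu, [/\ involutive mu, forall u, adj u (mu u) & M = matching_of mu].
Proof.
move=> /andP[/forallP disj /forallP cover].
have uniq_edge (e f : edge G) x :
    e \in M -> f \in M -> x \in val e -> x \in val f -> e = f.
  move=> eM fM xe xf; apply/eqP; apply: contraT => ef.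
  have /implyP/(_ eM)/forallP/(_ f)/implyP/(_ fM)/implyP/(_ ef) := disj e.
  by move=> /pred0P/(_ x) /=; rewrite xe xf.
have partner v : exists w,
    adj v w /\ exists2 e : edge G, e \in M & val e = [set v; w]%SET.
  have /existsP[e /andP[eM]] := cover v.
  have /existsP[a /existsP[b /andP[ab /eqP eE]]] := valP e.
  rewrite eE !inE => /orP[/eqP ->|/eqP ->].
    by exists b; split => //; exists e.
  exists a; rewrite adj_sym; split => //; exists e => //.
  by rewrite eE finset.setUC.
have [mu muP] := choice partner.
exists mu; split => [v|v|]; last 2 first.
- exact: (muP v).1.
- apply/setP => e; rewrite inE; apply/idP/existsP => [eM|[u /eqP eE]].
    have /existsP[a /existsP[b /andP[ab /eqP eE]]] := valP e.
    exists a; have [_ [f fM fE]] := muP a.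
    by rewrite (uniq_edge e f a) ?fE ?eE ?inE ?eqxx.
  have [_ [f fM fE]] := muP u; rewrite (_ : e = f)//.
  by apply: val_inj; rewrite eE fE.
have [_ [e eM eE]] := muP v; have [a2 [f fM fE]] := muP (mu v).
have ef : e = f.
  by apply: (uniq_edge _ _ (mu v)); rewrite ?eE ?fE ?inE ?eqxx ?orbT.
have : mu (mu v) \in val e by rewrite ef fE !inE eqxx orbT.
rewrite eE !inE => /orP[/eqP //|/eqP mumu].
by move: a2; rewrite mumu adj_irr.
Qed.

End perfect_matchings.

Lemma mem_matching_of (G : simple_graph) (mu : G -> G) (e : edge G) (u v : G) :
  involutive mu -> (forall w, adj w (mu w)) -> val e = [set u; v]%SET ->
  (e \in matching_of mu) = (mu u == v).
Proof.
move=> muK adj_mu eE; rewrite inE eE.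
apply/existsP/eqP => [[w /eqP uvw]|<-]; last first.
  by exists u.
have : u \in [set w; mu w]%SET by rewrite -uvw !inE eqxx.
rewrite !inE => uw; have {}uvw : [set u; v]%SET = [set u; mu u]%SET.
  by case/orP: uw => /eqP uE; rewrite uvw uE ?muK// finset.setUC.
have : mu u \in [set u; v]%SET by rewrite uvw !inE eqxx orbT.
rewrite !inE => /orP[/eqP muu|/eqP//].
by have := adj_mu u; rewrite muu adj_irr.
Qed.

(** * Coordinates in the honeycomb graph *)

Implicit Types (p q : int * int).

(** With two columns, all corners lie on six vertical lines, and on each of them the ordinate has a
    fixed parity. This turns membership into linear arithmetic. *)
Definition honeycomb_point (n : nat) p : bool :=
  let: (x, y) := p in
  [|| [&& x == 1, 1 <= y <= 2 * n%:Z - 1 & (y %% 2 == 1)%Z],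
      [&& x == 2, 0 <= y <= 2 * n%:Z & (y %% 2 == 0)%Z],
      [&& x == 4, 0 <= y <= 2 * n%:Z & (y %% 2 == 0)%Z],
      [&& x == 5, -1 <= y <= 2 * n%:Z - 1 & (y %% 2 == 1)%Z],
      [&& x == 7, -1 <= y <= 2 * n%:Z - 1 & (y %% 2 == 1)%Z] |
      [&& x == 8, 0 <= y <= 2 * n%:Z - 2 & (y %% 2 == 0)%Z]].

(** The squared length of a step (x, y) is (x^2 + 3 y^2) / 4, so the unit steps are (2, 0) and (1,
    1) up to signs. *)
Definition unit_distance p q : bool :=
  let: ((x, y), (x', y')) := (p, q) in
  [|| [&& x' == x + 2 & y' == y], [&& x == x' + 2 & y' == y] |
      ((x' == x + 1) || (x == x' + 1)) && ((y' == y + 1) || (y == y' + 1))].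

(* The vertices form three vertical zigzag paths: left (l), central (c) and
   right (r).  The digit is the first coordinate, and the index i increases
   upwards. *)
Definition l1 (i : nat) : int * int := (1, 2 * i%:Z + 1).
Definition l2 (i : nat) : int * int := (2, 2 * i%:Z).
Definition c4 (i : nat) : int * int := (4, 2 * i%:Z).
Definition c5 (i : nat) : int * int := (5, 2 * i%:Z - 1).
Definition r7 (i : nat) : int * int := (7, 2 * i%:Z - 1).
Definition r8 (i : nat) : int * int := (8, 2 * i%:Z).

Lemma point_l1 n i : honeycomb_point n (l1 i) = (i < n)%N.
Proof. by rewrite /honeycomb_point /=; lia. Qed.

Lemma point_l2 n i : honeycomb_point n (l2 i) = (i <= n)%N.
Proof. by rewrite /honeycomb_point /=; lia. Qed.

Lemma point_c4 n i : honeycomb_point n (c4 i) = (i <= n)%N.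
Proof. by rewrite /honeycomb_point /=; lia. Qed.

Lemma point_c5 n i : honeycomb_point n (c5 i) = (i <= n)%N.
Proof. by rewrite /honeycomb_point /=; lia. Qed.

Lemma point_r7 n i : honeycomb_point n (r7 i) = (i <= n)%N.
Proof. by rewrite /honeycomb_point /=; lia. Qed.

Lemma point_r8 n i : honeycomb_point n (r8 i) = (i < n)%N.
Proof. by rewrite /honeycomb_point /=; lia. Qed.

Definition pointE :=
  (point_l1, point_l2, point_c4, point_c5, point_r7, point_r8).

Variant point_spec n : int * int -> Prop :=
| PointL1 i of (i < n)%N : point_spec n (l1 i)
| PointL2 i of (i <= n)%N : point_spec n (l2 i)
| PointC4 i of (i <= n)%N : point_spec n (c4 i)
| PointC5 i of (i <= n)%N : point_spec n (c5 i)
| PointR7 i of (i <= n)%N : point_spec n (r7 i)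
| PointR8 i of (i < n)%N : point_spec n (r8 i).

Lemma honeycomb_pointP n p : honeycomb_point n p -> point_spec n p.
Proof.
case: p => x y; rewrite /honeycomb_point.
move=> /or3P[||/or4P[|||]] /and3P[/eqP-> yn y2].
- have -> : (1, y) = l1 `|(y %/ 2)%Z|%N by congr pair; lia.
  by apply: PointL1; lia.
- have -> : (2, y) = l2 `|(y %/ 2)%Z|%N by congr pair; lia.
  by apply: PointL2; lia.
- have -> : (4, y) = c4 `|(y %/ 2)%Z|%N by congr pair; lia.
  by apply: PointC4; lia.
(* Ordinates on this line are [2 * i - 1], starting at -1, so 1 is added before halving. *)
- have -> : (5, y) = c5 `|((y + 1)%R %/ 2)%Z|%N by congr pair; lia.
  by apply: PointC5; lia.
- have -> : (7, y) = r7 `|((y + 1)%R %/ 2)%Z|%N by congr pair; lia.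
  by apply: PointR7; lia.
- have -> : (8, y) = r8 `|(y %/ 2)%Z|%N by congr pair; lia.
  by apply: PointR8; lia.
Qed.

(** * Edges as pairs of points at unit distance *)

Definition bond n p q :=
  [/\ honeycomb_point n p, honeycomb_point n q & unit_distance p q].

Lemma bond_l1 n i q : bond n (l1 i) q -> q = l2 i \/ q = l2 i.+1.
Proof.
move=> [_ /honeycomb_pointP[] j jn] //; rewrite /unit_distance /= => d.
have [->|->] : j = i \/ j = i.+1 by lia.
  by left.
by right.
Qed.

(** The lower neighbour is given through [i = k.+1] because [l2 0] has none; a truncated predecessor
    would return its upper one. *)
Lemma bond_l2 n i q : bond n (l2 i) q ->
  [\/ q = c4 i, q = l1 i /\ (i < n)%N | exists2 k, i = k.+1 & q = l1 k].
Proof.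
move=> [_ /honeycomb_pointP[] j jn] //; rewrite /unit_distance /= => d.
  have [ji|ij] : j = i \/ i = j.+1 by lia.
    by apply: Or32; rewrite -ji.
  by apply: Or33; exists j.
by apply: Or31; congr c4; lia.
Qed.

Lemma bond_c4 n i q : bond n (c4 i) q -> [\/ q = l2 i, q = c5 i | q = c5 i.+1].
Proof.
move=> [_ /honeycomb_pointP[] j jn] //; rewrite /unit_distance /= => d.
  by apply: Or31; congr l2; lia.
have [->|->] : j = i \/ j = i.+1 by lia.
  exact: Or32.
exact: Or33.
Qed.

Lemma bond_c5 n i q : bond n (c5 i) q ->
  [\/ q = r7 i, q = c4 i | exists2 k, i = k.+1 & q = c4 k].
Proof.
move=> [_ /honeycomb_pointP[] j jn] //; rewrite /unit_distance /= => d.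
  have [ji|ij] : j = i \/ i = j.+1 by lia.
    by apply: Or32; rewrite -ji.
  by apply: Or33; exists j.
by apply: Or31; congr r7; lia.
Qed.

Lemma bond_r7 n i q : bond n (r7 i) q ->
  [\/ q = c5 i, q = r8 i | exists2 k, i = k.+1 & q = r8 k].
Proof.
move=> [_ /honeycomb_pointP[] j jn] //; rewrite /unit_distance /= => d.
  by apply: Or31; congr c5; lia.
have [ji|ij] : j = i \/ i = j.+1 by lia.
  by apply: Or32; rewrite -ji.
by apply: Or33; exists j.
Qed.

Lemma bond_r8 n i q : bond n (r8 i) q -> q = r7 i \/ q = r7 i.+1.
Proof.
move=> [_ /honeycomb_pointP[] j jn] //; rewrite /unit_distance /= => d.
have [->|->] : j = i \/ j = i.+1 by lia.
  by left.
by right.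
Qed.

Lemma unit_distanceC : commutative unit_distance.
Proof. by move=> [x y] [x' y']; rewrite /unit_distance; lia. Qed.

Local Ltac cell_lia :=
  rewrite /cell /hexagon /sides /= ?inE ?xpair_eqE; lia.

Lemma mem_honeycomb n p : (0 < n)%N ->
  (p \in flatten (cells 2 n)) = honeycomb_point n p.
Proof.
move=> n0; apply/flattenP/idP.
  move=> [_ /allpairsP[[i j] [/= + + ->]]].
  rewrite !mem_iota /cell /hexagon !inE => i12 j1n.
  have {i12}[->|->] : i = 1%N \/ i = 2%N by lia.
    by case/or4P => [|||/or3P[||]] /eqP ->; rewrite /honeycomb_point; lia.
  by case/or4P => [|||/or3P[||]] /eqP ->; rewrite /honeycomb_point; lia.
have cellI i j : (0 < i < 3)%N -> (0 < j <= n)%N -> p \in cell i j ->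
    exists2 c, c \in cells 2 n & p \in c.
  move=> i3 jn pc; exists (cell i j) => //.
  by apply: allpairs_f; rewrite mem_iota; lia.
(* On the lines of [l2], [c4], [c5] and [r7], index [i.+1] belongs to a cell of row [i.+1], while
   index 0 needs a cell of row 1. *)
move=> /honeycomb_pointP pS; case: pS cellI => [i lin|[|i] lin|[|i] lin|
  [|i] lin|[|i] lin|i lin] cellI.
- by apply: (cellI 1%N i.+1); cell_lia.
- by apply: (cellI 1%N 1%N); cell_lia.
- by apply: (cellI 1%N i.+1); cell_lia.
- by apply: (cellI 1%N 1%N); cell_lia.
- by apply: (cellI 1%N i.+1); cell_lia.
- by apply: (cellI 2%N 1%N); cell_lia.
- by apply: (cellI 1%N i.+1); cell_lia.
- by apply: (cellI 2%N 1%N); cell_lia.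
- by apply: (cellI 2%N i.+1); cell_lia.
- by apply: (cellI 2%N i.+1); cell_lia.
Qed.

Lemma honeycomb_vertexP n (u : honeycomb 2 n) : (0 < n)%N ->
  honeycomb_point n (val u).
Proof. by move=> n0; rewrite -mem_honeycomb//; exact: (valP u). Qed.

(** [honeycomb_adj] for bare points, free of membership proofs. *)
Definition cell_side n p q : bool :=
  has (fun c => ((p, q) \in sides c) || ((q, p) \in sides c)) (cells 2 n).

Lemma cell_sideC n p q : cell_side n p q = cell_side n q p.
Proof. by apply: eq_has => c; rewrite orbC. Qed.

Lemma cell_side_distance n p q : cell_side n p q -> unit_distance p q.
Proof.
case/hasP => c /allpairsP[[i j] [_ _ ->]].
rewrite /cell /hexagon /sides /= !inE.
by case/orP => /or4P[|||/or3P[||]] /eqP[-> ->]; rewrite /unit_distance; lia.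
Qed.

(** One class of the bipartition of the graph: every edge has an end in it, which halves the case
    analysis of edges. *)
Definition colour_class p :=
  [\/ exists i, p = l1 i, exists i, p = c4 i | exists i, p = r7 i].

Lemma coloured_bond_side n p q :
  (0 < n)%N -> bond n p q -> colour_class p -> cell_side n p q.
Proof.
move=> n0 pq; have [pP qP _] := pq.
have sideI i j : (0 < i < 3)%N -> (0 < j <= n)%N ->
    ((p, q) \in sides (cell i j)) || ((q, p) \in sides (cell i j)) ->
    cell_side n p q.
  move=> i3 jn pqc; apply/hasP; exists (cell i j) => //.
  by apply: allpairs_f; rewrite mem_iota; lia.
case=> -[i pE]; subst p; rewrite pointE in pP.
- case: (bond_l1 pq) => E; subst q.
    by apply: (sideI 1%N i.+1); cell_lia.
  by apply: (sideI 1%N i.+1); cell_lia.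
- case: (bond_c4 pq) => E; subst q.
  + case: i => [|i] in pP qP pq sideI *.
      by apply: (sideI 1%N 1%N); cell_lia.
    by apply: (sideI 1%N i.+1); cell_lia.
  + case: i => [|i] in pP qP pq sideI *.
      by apply: (sideI 2%N 1%N); cell_lia.
    by apply: (sideI 1%N i.+1); cell_lia.
  + rewrite pointE in qP.
    by apply: (sideI 2%N i.+1); cell_lia.
- case: (bond_r7 pq) => [E|E|[k iE E]]; subst q.
  + case: i => [|i] in pP qP pq sideI *.
      by apply: (sideI 2%N 1%N); cell_lia.
    by apply: (sideI 2%N i.+1); cell_lia.
  + rewrite pointE in qP.
    by apply: (sideI 2%N i.+1); cell_lia.
  + by apply: (sideI 2%N i); cell_lia.
Qed.

Lemma bond_coloured n p q : bond n p q -> colour_class p \/ colour_class q.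
Proof.
move=> pq; have [/honeycomb_pointP pS _ _] := pq.
case: pS pq => i _ pq.
- by left; apply: Or31; exists i.
- right; case: (bond_l2 pq) => [->|[-> _]|[k _ ->]].
  + by apply: Or32; exists i.
  + by apply: Or31; exists i.
  + by apply: Or31; exists k.
- by left; apply: Or32; exists i.
- right; case: (bond_c5 pq) => [->|->|[k _ ->]].
  + by apply: Or33; exists i.
  + by apply: Or32; exists i.
  + by apply: Or32; exists k.
- by left; apply: Or33; exists i.
- right; case: (bond_r8 pq) => ->; apply: Or33.
    by exists i.
  by exists i.+1.
Qed.

(** By symmetry, only the edges that leave [colour_class] need an explicit cell. *)
Lemma cell_sideE n p q :
  (0 < n)%N -> honeycomb_point n p -> honeycomb_point n q ->
  cell_side n p q = unit_distance p q.
Proof.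
move=> n0 pP qP; apply/idP/idP; first exact: cell_side_distance.
move=> pq; have pqb : bond n p q by [].
have [|qcol] := bond_coloured pqb; first exact: coloured_bond_side.
rewrite cell_sideC; apply: coloured_bond_side qcol => //.
by split; rewrite // unit_distanceC.
Qed.

Lemma honeycomb_adjE n (u v : honeycomb 2 n) : (0 < n)%N ->
  adj u v = unit_distance (val u) (val v).
Proof. by move=> n0; apply: cell_sideE => //; exact: honeycomb_vertexP. Qed.

(** * Perfect matchings of the honeycomb graph *)

(* A perfect matching, given by the involution that exchanges the ends of its
   edges; the values outside the graph are arbitrary. *)
Definition dimer n (mu : int * int -> int * int) :=
  forall p, honeycomb_point n p -> bond n p (mu p) /\ mu (mu p) = p.

Lemma dimer_bond n mu p : dimer n mu -> honeycomb_point n p -> bond n p (mu p).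
Proof. by move=> mudim /mudim[]. Qed.

Lemma dimerK n mu p q :
  dimer n mu -> honeycomb_point n p -> mu p = q -> mu q = p.
Proof. by move=> mudim /mudim[_ + <-]. Qed.

(** * Edges that force the edge from [l2 0] to [l1 0] *)

Section propagation.
Variables (n : nat) (mu : int * int -> int * int).
Hypothesis mudim : dimer n mu.

Let nb p (hp : honeycomb_point n p) := dimer_bond mudim hp.
Let sw p q (hp : honeycomb_point n p) (E : mu p = q) := dimerK mudim hp E.

(** Descent along the left path: once [l2 i.+1] is taken, [l1 i] is left with [l2 i] only. *)
Lemma propagate_l2 i : (i < n)%N -> mu (l2 i) = l1 i -> mu (l2 0) = l1 0.
Proof.
elim: i => // i IHi lin E.
have pi : honeycomb_point n (l1 i) by rewrite point_l1; lia.
case: (bond_l1 (nb pi)) => F; have := sw pi F.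
  by apply: IHi; lia.
by rewrite E => -[]; lia.
Qed.

Lemma propagate_l2_c4 i :
  (0 < i <= n)%N -> mu (l2 i) = c4 i -> mu (l2 0) = l1 0.
Proof.
case: i => // i lin E.
have pi : honeycomb_point n (l1 i) by rewrite point_l1; lia.
case: (bond_l1 (nb pi)) => F; have := sw pi F.
  by apply: propagate_l2; lia.
by rewrite E.
Qed.

Lemma propagate_c4_0 : mu (c4 0) <> l2 0 -> mu (l2 0) = l1 0.
Proof.
move=> E; have p0 : honeycomb_point n (l2 0) by rewrite point_l2.
by case: (bond_l2 (nb p0)) => [F|[]|[]//]; first by case: E; rewrite (sw p0 F).
Qed.

(** The same descent on the right path ends with [r7 0] matched to [r8 0]; then [c5 0] must take
    [c4 0], and [l2 0] is left with [l1 0]. *)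
Lemma propagate_r7 i : (i < n)%N -> mu (r7 i) = r8 i -> mu (l2 0) = l1 0.
Proof.
elim: i => [_ E|i IHi lin E].
  have p0 : honeycomb_point n (c5 0) by rewrite point_c5.
  apply: propagate_c4_0; case: (bond_c5 (nb p0)) => [F|F|[]//].
    by have := sw p0 F; rewrite E.
  by rewrite (sw p0 F).
have pi : honeycomb_point n (r8 i) by rewrite point_r8; lia.
case: (bond_r8 (nb pi)) => F; have := sw pi F.
  by apply: IHi; lia.
by rewrite E => -[]; lia.
Qed.

(** In the inductive step [c4 i.+1] is taken, so [c5 i.+1] goes to [c4 i], which continues the
    descent, or to [r7 i.+1], which starts one on the right path. *)
Lemma propagate_c4 i : (i < n)%N -> mu (c4 i) = c5 i.+1 -> mu (l2 0) = l1 0.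
Proof.
elim: i => [_ E|i IHi lin E]; first by apply: propagate_c4_0; rewrite E.
have pi : honeycomb_point n (c5 i.+1) by rewrite point_c5; lia.
case: (bond_c5 (nb pi)) => [F|F|[_ [<-] F]]; have Fi := sw pi F.
- have pr : honeycomb_point n (r8 i) by rewrite point_r8; lia.
  case: (bond_r8 (nb pr)) => G; have := sw pr G; last by rewrite Fi.
  by apply: propagate_r7; lia.
- by move: Fi; rewrite E => -[]; lia.
- by apply: IHi; rewrite // ltnW.
Qed.

(** With [r7 n] taken, [r8 n.-1] has to go down to [r7 n.-1]. *)
Lemma propagate_c5 : (0 < n)%N -> mu (c5 n) = r7 n -> mu (l2 0) = l1 0.
Proof.
move=> n0 E; have pn : honeycomb_point n (c5 n) by rewrite point_c5.
have F := sw pn E.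
have pi : honeycomb_point n (r8 n.-1) by rewrite point_r8; lia.
case: (bond_r8 (nb pi)) => G; have := sw pi G; last by rewrite prednK// F.
by apply: propagate_r7; lia.
Qed.

(** The left path is forced upwards until [l2 n] takes [c4 n]. Then [c5 n], whose neighbours [c4 n]
    and [r7 n] are taken, needs [c4 n.-1], which is free only if [n.-1 = 0]. *)
Lemma dimer_avoids : (0 < n)%N ->
  mu (l2 0) = l1 0 -> mu (r7 n) = r8 n.-1 ->
  (forall i, (0 < i < n)%N -> mu (c4 i) = c5 i) -> n = 1%N.
Proof.
move=> n0 A B C.
have up i : (i < n)%N -> mu (l2 i) = l1 i.
  elim: i => // i IHi lin.
  have pi : honeycomb_point n (l2 i.+1) by rewrite point_l2; lia.
  have pi' : honeycomb_point n (l2 i) by rewrite point_l2; lia.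
  case: (bond_l2 (nb pi)) => [F|[]//|[_ [<-] F]].
    by have := sw pi F; rewrite C.
  have := sw pi F; rewrite (sw pi' (IHi _)); last by lia.
  by case; lia.
have [m nE] : exists m, n = m.+1 by exists n.-1; rewrite prednK.
have pn : honeycomb_point n (l2 n) by rewrite point_l2.
have pm : honeycomb_point n (l2 m) by rewrite point_l2; lia.
have pr : honeycomb_point n (r7 n) by rewrite point_r7.
have pc : honeycomb_point n (c5 n) by rewrite point_c5.
have n4 : mu (c4 n) = l2 n.
  case: (bond_l2 (nb pn)) => [F|[_]|[k]]; first exact: sw F.
    by rewrite ltnn.
  rewrite {1}nE => -[<-] F; have := sw pn F.
  by rewrite (sw pm (up _ _)) ?nE// => -[]; lia.
case: (bond_c5 (nb pc)) => [F|F|[k]].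
- by have := sw pc F; rewrite B.
- by have := sw pc F; rewrite n4.
- rewrite nE => -[<-] F; have := sw pc; rewrite nE => /(_ _ F).
  by case: m {pm up F} nE => // m nE; rewrite C ?nE ?ltnS ?leqnn// => -[]; lia.
Qed.

End propagation.

(* The half-turn of the graph; it exchanges [special n 0] and [special n n]. *)
Definition rotate n p : int * int := (9 - p.1, 2 * n%:Z - 1 - p.2).

Lemma rotateK n : involutive (rotate n).
Proof. by move=> [x y]; rewrite /rotate /=; congr pair; lia. Qed.

Lemma rotate_l1 n i : (i < n)%N -> rotate n (l1 i) = r8 (n.-1 - i).
Proof. by move=> lin; rewrite /rotate /=; congr pair; lia. Qed.

Lemma rotate_l2 n i : (i <= n)%N -> rotate n (l2 i) = r7 (n - i).
Proof. by move=> lin; rewrite /rotate /=; congr pair; lia. Qed.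

Lemma rotate_c4 n i : (i <= n)%N -> rotate n (c4 i) = c5 (n - i).
Proof. by move=> lin; rewrite /rotate /=; congr pair; lia. Qed.

Lemma rotate_c5 n i : (i <= n)%N -> rotate n (c5 i) = c4 (n - i).
Proof. by move=> lin; rewrite /rotate /=; congr pair; lia. Qed.

Lemma rotate_r7 n i : (i <= n)%N -> rotate n (r7 i) = l2 (n - i).
Proof. by move=> lin; rewrite /rotate /=; congr pair; lia. Qed.

Lemma rotate_r8 n i : (i < n)%N -> rotate n (r8 i) = l1 (n.-1 - i).
Proof. by move=> lin; rewrite /rotate /=; congr pair; lia. Qed.

Lemma rotate_point n p : honeycomb_point n p -> honeycomb_point n (rotate n p).
Proof.
case/honeycomb_pointP => i iP.
- by rewrite rotate_l1// pointE; lia.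
- by rewrite rotate_l2// pointE; lia.
- by rewrite rotate_c4// pointE; lia.
- by rewrite rotate_c5// pointE; lia.
- by rewrite rotate_r7// pointE; lia.
- by rewrite rotate_r8// pointE; lia.
Qed.

Lemma rotate_bond n p q : bond n p q -> bond n (rotate n p) (rotate n q).
Proof.
move=> [pP qP pq]; split; try exact: rotate_point.
by case: p q pq {pP qP} => [x y] [x' y']; rewrite /unit_distance /=; lia.
Qed.

Lemma rotate_dimer n mu : dimer n mu -> dimer n (rotate n \o mu \o rotate n).
Proof.
move=> mudim p /rotate_point pP; have [pq muK] := mudim _ pP.
split; last by rewrite /= rotateK muK rotateK.
by rewrite -{1}[p](rotateK n); exact: rotate_bond.
Qed.

Lemma unit_l1_l2 i : unit_distance (l1 i) (l2 i).
Proof. by rewrite /unit_distance /=; lia. Qed.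

Lemma unit_l1_l2S i : unit_distance (l1 i) (l2 i.+1).
Proof. by rewrite /unit_distance /=; lia. Qed.

Lemma unit_l2_c4 i : unit_distance (l2 i) (c4 i).
Proof. by rewrite /unit_distance /= eqxx. Qed.

Lemma unit_c4_c5 i : unit_distance (c4 i) (c5 i).
Proof. by rewrite /unit_distance /=; lia. Qed.

Lemma unit_c5_r7 i : unit_distance (c5 i) (r7 i).
Proof. by rewrite /unit_distance /= eqxx. Qed.

Lemma unit_r7_r8 i : unit_distance (r7 i) (r8 i).
Proof. by rewrite /unit_distance /=; lia. Qed.

Lemma unit_r7S_r8 i : unit_distance (r7 i.+1) (r8 i).
Proof. by rewrite /unit_distance /=; lia. Qed.

Definition unitE := (unit_l1_l2, unit_l1_l2S, unit_l2_c4, unit_c4_c5,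
  unit_c5_r7, unit_r7_r8, unit_r7S_r8).

(* [special n 0] lies in the matchings with a > 0, [special n n] in those with
   b < n, and otherwise [special n i] in those with i < b or a < i. *)
Definition special n i : (int * int) * (int * int) :=
  if i == 0%N then (l2 0, l1 0)
  else if i == n then (r7 n, r8 n.-1)
  else (c4 i, c5 i).

Lemma special_bond n i : (1 < n)%N -> (i <= n)%N ->
  bond n (special n i).1 (special n i).2.
Proof.
move=> n1 lin; rewrite /special; case: eqP => i0; last case: eqP => iN.
all: by split; rewrite ?pointE /unit_distance /=; lia.
Qed.

Lemma dimer_misses_special n mu : (1 < n)%N -> dimer n mu ->
  ~ forall i, (i <= n)%N -> mu (special n i).1 = (special n i).2.
Proof.
move=> n1 mudim H; suff : n = 1%N by lia.
apply: (dimer_avoids mudim); first by lia.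
- exact: (H 0%N).
- by have := H n (leqnn n); rewrite /special eqxx; case: eqP => //; lia.
- move=> i lin; have := H i; rewrite /special.
  by case: (i =P 0%N) => [|_]; [lia|case: (i =P n) => [|_ ->//]; lia].
Qed.

(** In the complex this says that the special edge [i] dominates the edge from [p] to [q]. *)
Definition forces n p q i := forall mu, dimer n mu -> mu p = q ->
  mu (special n i).1 = (special n i).2.

Lemma forces_sym n p q i : bond n p q -> forces n p q i -> forces n q p i.
Proof.
move=> [_ qP _] pqi mu mudim E; apply: pqi => //.
exact: (dimerK mudim qP E).
Qed.

(** Conjugation by the half-turn carries the descents above to the opposite corner. *)
Lemma forces_rotate n p q : (0 < n)%N ->
  forces n (rotate n p) (rotate n q) 0 -> forces n p q n.
Proof.
move=> n0 pq0 mu mudim E.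
have /= := pq0 _ (rotate_dimer mudim); rewrite !rotateK E => /(_ erefl).
rewrite rotate_l2// subn0 => /(congr1 (rotate n)).
by rewrite rotateK rotate_l1// subn0 /special eqxx; case: eqP => [|//]; lia.
Qed.

(** Apart from the edges from [c4 i] to [c5 i] with [0 < i < n], which are special themselves, every
    edge or its image under the half-turn forces [special n 0]. *)
Lemma bond_forces n p q : (1 < n)%N -> bond n p q ->
  exists2 i, (i <= n)%N & forces n p q i.
Proof.
move=> n1 pq; have n0 : (0 < n)%N by lia.
pose forced p' q' := exists2 i, (i <= n)%N & forces n p' q' i.
have sym p' q' : bond n p' q' -> forced q' p' -> forced p' q'.
  move=> b [i lin Fi]; exists i => //; apply: forces_sym Fi.
  by case: b => *; split => //; rewrite unit_distanceC.
have zero p' q' : forces n p' q' 0 -> forced p' q' by exists 0%N.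
have last p' q' : forces n (rotate n p') (rotate n q') 0 -> forced p' q'.
  by move=> /(forces_rotate n0); exists n.
have f1 i : (i < n)%N -> forces n (l2 i) (l1 i) 0.
  by move=> lin mu mudim; exact: (propagate_l2 mudim lin).
have f2 i : (0 < i <= n)%N -> forces n (l2 i) (c4 i) 0.
  by move=> lin mu mudim; exact: (propagate_l2_c4 mudim lin).
have f3 i : (i < n)%N -> forces n (r7 i) (r8 i) 0.
  by move=> lin mu mudim; exact: (propagate_r7 mudim lin).
have f4 i : (i < n)%N -> forces n (c4 i) (c5 i.+1) 0.
  by move=> lin mu mudim; exact: (propagate_c4 mudim lin).
have f5 : forces n (c4 0) (c5 0) 0.
  by move=> mu mudim E; apply: (propagate_c4_0 mudim); rewrite E.
have f6 : forces n (c5 n) (r7 n) 0.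
  by move=> mu mudim; exact: (propagate_c5 mudim n0).
have g12 i : (i < n)%N -> forced (l2 i.+1) (l1 i).
  move=> lin; apply: last; rewrite rotate_l2// rotate_l1//.
  by rewrite (_ : n.-1 - i = n - i.+1)%N; [apply: f3|]; lia.
have g78 i : (i < n)%N -> forced (r7 i.+1) (r8 i).
  move=> lin; apply: last; rewrite rotate_r7// rotate_r8//.
  by rewrite (_ : n.-1 - i = n - i.+1)%N; [apply: f1|]; lia.
have g24 i : (i <= n)%N -> forced (l2 i) (c4 i).
  (* The half-turn takes the edge at index 0 to the reverse of that of [f6], hence [sym]. *)
  case: i => [_|i lin]; last exact/zero/f2.
  apply: sym; first by split; rewrite ?pointE ?unitE.
  by apply: last; rewrite rotate_c4// rotate_l2// subn0.
have g57 i : (i <= n)%N -> forced (c5 i) (r7 i).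
  rewrite leq_eqVlt => /orP[/eqP ->|lin]; first exact/zero/f6.
  apply: sym; first by split; rewrite ?pointE ?(ltnW lin)// unitE.
  apply: last; rewrite rotate_c5 1?ltnW// rotate_r7 1?ltnW//.
  by apply: f2; lia.
have g45 i : (i <= n)%N -> forced (c4 i) (c5 i).
  case: (posnP i) => [->|i0] lin; first exact/zero/f5.
  have [->|iN] := eqVneq i n.
    apply: sym; first by split; rewrite ?pointE ?unitE.
    by apply: last; rewrite rotate_c5// rotate_c4// subnn.
  exists i => // mu _; rewrite /special (negbTE iN).
  by case: eqP => // i0'; lia.
have [/honeycomb_pointP pS _ _] := pq; case: pS pq => i lin pq.
- case: (bond_l1 pq) => E; subst q; apply: sym => //; first exact/zero/f1.
  exact: g12.
- case: (bond_l2 pq) => [|[]|[k]] E; subst.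
  + exact: g24.
  + by move=> ?; exact/zero/f1.
  + by move=> E; subst; apply: g12.
- case: (bond_c4 pq) => E; subst q; [apply: sym => //; exact: g24|exact: g45|].
  by apply/zero/f4; case: pq => _; rewrite pointE.
- case: (bond_c5 pq) => [E|E|[k]]; first by subst q; exact: g57.
    by subst q; apply: sym => //; exact: g45.
  by move=> E E'; subst; apply: sym => //; apply/zero/f4.
- case: (bond_r7 pq) => [E|E|[k]].
  + by subst q; apply: sym => //; exact: g57.
  + subst q.
    by apply/zero/f3; case: pq => _; rewrite pointE.
  + by move=> E E'; subst; exact: g78.
- case: (bond_r8 pq) => E; subst q; apply: sym => //; first exact/zero/f3.
  exact: g78.
Qed.

(* The matching (k, k) of the header. *)
Definition diagonal (k : nat) p : int * int :=
  let: (x, y) := p in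
  if x == 1 then (2, if y < 2 * k%:Z then y - 1 else y + 1)
  else if x == 2 then
    if y < 2 * k%:Z then (1, y + 1)
    else if y == 2 * k%:Z then (4, y) else (1, y - 1)
  else if x == 4 then if y == 2 * k%:Z then (2, y) else (5, y - 1)
  else if x == 5 then if y + 1 == 2 * k%:Z then (7, y) else (4, y + 1)
  else if x == 7 then
    if y + 1 < 2 * k%:Z then (8, y + 1)
    else if y + 1 == 2 * k%:Z then (5, y) else (8, y - 1)
  else (7, if y < 2 * k%:Z then y - 1 else y + 1).

Lemma diagonal_l1 k i : diagonal k (l1 i) = if (i < k)%N then l2 i else l2 i.+1.
Proof. by rewrite /diagonal /=; do 2! case: ifPn => ?; congr pair; lia. Qed.

(** The predecessor is genuine, since the last case has [k < i]. *)
Lemma diagonal_l2 k i : diagonal k (l2 i) =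
  if (i < k)%N then l1 i else if i == k then c4 i else l1 i.-1.
Proof.
by rewrite /diagonal /=; do 4! (try case: ifPn => ?); try congr pair; lia.
Qed.

Lemma diagonal_c4 k i : diagonal k (c4 i) = if i == k then l2 i else c5 i.
Proof. by rewrite /diagonal /=; do 2! case: ifPn => ?; try congr pair; lia. Qed.

Lemma diagonal_c5 k i : diagonal k (c5 i) = if i == k then r7 i else c4 i.
Proof. by rewrite /diagonal /=; do 2! case: ifPn => ?; try congr pair; lia. Qed.

Lemma diagonal_r7 k i : diagonal k (r7 i) =
  if (i < k)%N then r8 i else if i == k then c5 i else r8 i.-1.
Proof.
by rewrite /diagonal /=; do 4! (try case: ifPn => ?); try congr pair; lia.
Qed.

Lemma diagonal_r8 k i : diagonal k (r8 i) = if (i < k)%N then r7 i else r7 i.+1.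
Proof. by rewrite /diagonal /=; do 2! case: ifPn => ?; congr pair; lia. Qed.

Definition diagonalE := (diagonal_l1, diagonal_l2, diagonal_c4, diagonal_c5,
  diagonal_r7, diagonal_r8).

Lemma diagonal_dimer n k : (k <= n)%N -> dimer n (diagonal k).
Proof.
move=> kn p /honeycomb_pointP[] i lin; rewrite diagonalE /bond.
- case: ifPn => ik; rewrite !pointE diagonalE unitE ?ik.
    by split; [split|] => //; lia.
  by rewrite ifN 1?ifN; [split; [split|] => //|..]; lia.
- case: ifPn => ik; last case: eqP => [ik'|ik'].
  + rewrite !pointE diagonalE unit_distanceC unitE ik.
    by split; [split|] => //; lia.
  + by rewrite !pointE diagonalE unitE ik' eqxx; split; [split|] => //; lia.
  + case: i => [|i] in lin ik ik' *; first lia.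
    rewrite !pointE diagonalE unit_distanceC unitE ifN; last lia.
    by split; [split|] => //; lia.
- case: eqP => ik.
    rewrite !pointE diagonalE unit_distanceC unitE ik ltnn eqxx.
    by split; [split|] => //; lia.
  rewrite !pointE diagonalE unitE ifN; last exact/eqP.
  by split; [split|] => //; lia.
- case: eqP => ik.
    rewrite !pointE diagonalE unitE ik ltnn eqxx.
    by split; [split|] => //; lia.
  rewrite !pointE diagonalE unit_distanceC unitE ifN; last exact/eqP.
  by split; [split|] => //; lia.
- case: ifPn => ik; last case: eqP => [ik'|ik'].
  + by rewrite !pointE diagonalE unitE ik; split; [split|] => //; lia.
  + rewrite !pointE diagonalE unit_distanceC unitE ik' eqxx.
    by split; [split|] => //; lia.
  + case: i => [|i] in lin ik ik' *; first lia.
    rewrite !pointE diagonalE unitE ifN; last lia.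
    by split; [split|] => //; lia.
- case: ifPn => ik; rewrite !pointE diagonalE unit_distanceC unitE ?ik.
    by split; [split|] => //; lia.
  by rewrite ifN 1?ifN; [split; [split|] => //|..]; lia.
Qed.

(** With a = b = k, the condition a > 0 fails only for k = 0, b < n only for k = n, and the
    alternative i < b or a < i only for i = k. *)
Lemma diagonal_special n k i :
  (1 < n)%N -> (k <= n)%N -> (i <= n)%N -> i != k ->
  diagonal k (special n i).1 = (special n i).2.
Proof.
move=> n1 kn lin ik; rewrite /special; case: eqP => i0; last case: eqP => iN.
- by rewrite diagonalE; case: ifPn => //; lia.
- by rewrite diagonalE; do 2! (case: ifPn => [?|?]; first by exfalso; lia).
- by rewrite diagonalE (negbTE ik).
Qed.

(** * Passage between matchings of the graph and involutions of points *)

Definition matched_by n (M : {set edge (honeycomb 2 n)}) mu :=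
  forall (e : edge (honeycomb 2 n)) (u v : honeycomb 2 n),
    val e = [set u; v]%SET -> (e \in M) = (mu (val u) == val v).

Lemma perfect_matching_dimer n (M : {set edge (honeycomb 2 n)}) :
  (0 < n)%N -> perfect_matching M ->
  exists2 mu, dimer n mu & matched_by M mu.
Proof.
move=> n0 /perfect_matching_partner[m [mK adj_m ->]].
pose mu p := if insub p is Some u then val (m (u : honeycomb 2 n)) else p.
have muE (u : honeycomb 2 n) : mu (val u) = val (m u) by rewrite /mu valK.
exists mu => [p pP|e u v eE]; last by rewrite (mem_matching_of mK adj_m eE) muE.
rewrite -mem_honeycomb// in pP.
have [u <-] : exists u : honeycomb 2 n, val u = p.
  by exists (Sub p pP); rewrite SubK.
rewrite !muE mK; split => //; split; try exact: honeycomb_vertexP.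
by rewrite -honeycomb_adjE.
Qed.

Lemma dimer_perfect_matching n mu : (0 < n)%N -> dimer n mu ->
  exists2 M : {set edge (honeycomb 2 n)}, perfect_matching M & matched_by M mu.
Proof.
move=> n0 mudim.
(* A dimer preserves the set of vertices, so [insubd] never falls back on its default [u]. *)
pose m (u : honeycomb 2 n) : honeycomb 2 n := insubd u (mu (val u)).
have mE u : val (m u) = mu (val u).
  rewrite val_insubd mem_honeycomb//.
  by have [[_ -> _] _] := mudim _ (honeycomb_vertexP u n0).
have mK : involutive m.
  move=> u; apply: val_inj; rewrite !mE.
  by case: (mudim _ (honeycomb_vertexP u n0)).
have adj_m u : adj u (m u).
  rewrite honeycomb_adjE// mE.
  by case: (mudim _ (honeycomb_vertexP u n0)) => -[].
exists (matching_of m); first exact: perfect_matching_of.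
by move=> e u v /(mem_matching_of mK adj_m) ->; rewrite -(inj_eq val_inj) mE.
Qed.

Lemma bond_edge n p q : (0 < n)%N -> bond n p q ->
  exists (e : edge (honeycomb 2 n)) (u v : honeycomb 2 n),
    [/\ val u = p, val v = q & val e = [set u; v]%SET].
Proof.
move=> n0 [pP qP pq]; rewrite -!mem_honeycomb// in pP qP.
pose u : honeycomb 2 n := Sub p pP; pose v : honeycomb 2 n := Sub q qP.
have uvP : is_edge [set u; v]%SET.
  apply/existsP; exists u; apply/existsP; exists v.
  by rewrite honeycomb_adjE// !SubK pq eqxx.
exists (exist (fun e : {set honeycomb 2 n} => is_edge e) _ uvP), u, v.
by rewrite !SubK.
Qed.

Theorem theorem3p10 (R : realType) (n : nat) (hn : (2 <= n)%N) :
  homotopy_equivalent R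
    (geometric_realization R (perfect_matching_complex (honeycomb 2 n)))
    (sphere R n.-1).
Proof.
have n0 : (0 < n)%N by lia.
(* With [n = d.+1], the n + 1 special edges are indexed by ['I_d.+2] and the sphere has dimension
   [d]. *)
case: n hn n0 => [//|d] hn n0; rewrite [d.+1.-1]/=.
pose G := honeycomb 2 d.+1; pose K := perfect_matching_complex G.
have faceP (s : {set edge G}) :
    reflect (exists2 M, perfect_matching M & s \subset M) (s \in faces K).
  rewrite inE; apply: (iffP existsP) => [[M /andP[]]|[M pM sM]]; exists M => //.
  by rewrite pM.
have /choice[f fP] (i : 'I_d.+2) : exists e : edge G, exists u v : G,
    [/\ val u = (special d.+1 i).1, val v = (special d.+1 i).2
      & val e = [set u; v]%SET].
  by apply: bond_edge => //; apply: special_bond => //; rewrite -ltnS.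
have memf mu (M : {set edge G}) i : matched_by M mu ->
    (f i \in M) = (mu (special d.+1 i).1 == (special d.+1 i).2).
  by move=> muM; have [u [v [<- <- eE]]] := fP i; exact: muM.
have face_f (t : {set 'I_d.+2}) :
    (f @: t \in faces K)%SET = (t != [set: _])%SET.
  apply/faceP/idP => [[M /(perfect_matching_dimer n0)[mu mudim muM] sM]|].
    apply/eqP => tT; apply: (dimer_misses_special hn mudim) => i id.
    apply/eqP; rewrite -(memf _ _ (Ordinal (id : (i < d.+2)%N)) muM).
    by apply: (fintype.subsetP sM); apply: imset_f; rewrite tT inE.
  (* An index [k] missing from [t] gives the matching (k, k), which contains every other special
     edge. *)
  rewrite -finset.subTset => /subsetPn[k _ kt].
  have kd : (k <= d.+1)%N by rewrite -ltnS.
  have [M pM muM] := dimer_perfect_matching n0 (diagonal_dimer kd).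
  exists M => //; apply/fintype.subsetP => _ /imsetP[i it ->].
  rewrite (memf _ _ i muM); apply/eqP/diagonal_special => //.
    by rewrite -ltnS.
  by apply: contraNneq kt => /val_inj <-.
(* Every matching through [e] contains the forced special edge, so the matching that witnesses a
   face through [e] also witnesses the enlarged one. *)
have dominated (e : edge G) : exists i,
    forall s : {set _}, s \in faces K -> e \in s -> (f i |: s \in faces K)%SET.
  have /existsP[u /existsP[v /andP[uv /eqP eE]]] := valP e.
  have [|i id iP] := @bond_forces d.+1 (val u) (val v) hn.
    by split; rewrite -?honeycomb_adjE//; exact: honeycomb_vertexP.
  exists (Ordinal (id : (i < d.+2)%N)) => s /faceP[M pM sM] es.
  apply/faceP; exists M => //.
  have [mu mudim muM] := perfect_matching_dimer n0 pM.
  rewrite finset.subUset sM andbT finset.sub1set (memf _ _ _ muM).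
  apply/eqP/(iP _ mudim)/eqP; rewrite -(muM _ _ _ eE).
  exact: (fintype.subsetP sM).
have [r fK dom_r] := domination_retract face_f dominated.
exact: (realization_homotopy_sphere R face_f fK dom_r).
Qed.
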